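(* If $m$ and $n$ are non-negative integers and $s, t$ are integers, then \[ L_t \sum_{k = 0}^n \binom{m - 2n + 2k}{2k}\frac{F_s^{2(n - k)} L_s^{2k}}{5^{k}} - F_t \sum_{k = 1}^n \binom{m - 2n + 2k - 1}{2k - 1} \frac{F_s^{2(n - k) + 1} L_s^{2k - 1}}{5^{k - 1}} =\Big(\frac{4}{5}\Big)^{n}\sum_{k = 0}^{2n} (-1)^k \binom{m + 1}{k} \frac{L_s^k L_{s(2n - k) + t}}{2^{k}}, \] \[ F_t \sum_{k = 0}^n \binom{m - 2n + 2k}{2k} \frac{F_s^{2(n -k)}L_s^{2k}}{5^k} - L_t \sum_{k = 1}^n \binom{m - 2n + 2k - 1}{2k - 1}\frac{F_s^{2(n - k) + 1} L_s^{2k - 1}}{5^k} = \Big(\frac{4}{5}\Big)^n\sum_{k = 0}^{2n} ( - 1)^k \binom{m + 1}{k} \frac{L_s^k F_{s(2n - k) + t}}{2^k}, \] \[ L_t \sum_{k = 1}^n \binom{m - 2n + 2k}{2k -1}\frac{F_s^{2(n - k)} L_s^{2k - 1}}{ 5^k} - F_t \sum_{k = 0}^{n - 1} \binom{m - 2n + 2k + 1}{2k}\frac{F_s^{2(n - k) - 1} L_s^{2k}}{5^k} =\Big(\frac{4}{5}\Big)^n \sum_{k = 0}^{2n - 1} ( - 1)^{k - 1} \binom{m + 1}{k}\frac{L_s^k L_{s(2n - k - 1) + t}}{2^{k+1}}, \] \[ F_t \sum_{k = 1}^n \binom{m - 2n + 2k}{2k - 1}\frac{F_s^{2(n - k)}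 L_s^{2k - 1}} {5^k} - L_t \sum_{k = 0}^{n - 1} \binom{m - 2n + 2k + 1}{2k}\frac{F_s^{2(n - k) - 1} L_s^{2k}}{5^{k + 1}} = \Big(\frac{4}{5}\Big)^n\sum_{k = 0}^{2n - 1} ( - 1)^{k - 1} \binom{m + 1}{k} \frac{L_s^k F_{s(2n - k - 1) + t}}{2^{k + 1}}. \]
   Context: $F_j$ and $L_j$ denote the Fibonacci and Lucas numbers: $F_0=0,F_1=1$, $L_0=2,L_1=1$, both satisfying $X_j=X_{j-1}+X_{j-2}$, extended to all integer indices via the recurrence (so $F_{-j}=(-1)^{j+1}F_j$, $L_{-j}=(-1)^jL_j$). For a complex number $x$ and a non-negative integer $k$, $\binom{x}{k}=x(x-1)\cdots(x-k+1)/k!$ (so the upper index may be negative). *)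

(* Defs.v *)
From mathcomp Require Import all_boot all_order all_algebra.
Set Implicit Arguments.
Unset Strict Implicit.
Unset Printing Implicit Defensive.
Import Order.TTheory GRing.Theory Num.Theory.
Local Open Scope ring_scope.

(* The two-sided integer sequence X_j with X_0 = a, X_1 = b and
   X_j = X_(j-1) + X_(j-2) for every integer j.  The iterated pair is
   (X_i, X_(i+1)), stepped forwards or backwards. *)
Definition fibseq (a b j : int) : int :=
  match j with
  | Posz n => (iter n (fun p : int * int => (p.2, p.1 + p.2)) (a, b)).1
  | Negz n => (iter n.+1 (fun p : int * int => (p.2 - p.1, p.1)) (a, b)).1
  end.

Definition fib (j : int) : int := fibseq 0 1 j.

Definition lucas (j : int) : int := fibseq 2 1 j.

Lemma fibseq_rec (a b j : int) :
  fibseq a b j = fibseq a b (j - 1) + fibseq a b (j - 2).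
Proof.
case: j => [[|[|n]]|n].
- change (a = (b - a) + (a - (b - a))).
  by rewrite addrC subrK.
- change (b = a + (b - a)).
  by rewrite addrC subrK.
- have -> : Posz n.+2 - 1 = Posz n.+1 by rewrite -addn1 PoszD addrK.
  have -> : Posz n.+2 - 2 = Posz n by rewrite -addn2 PoszD addrK.
  by rewrite /fibseq !iterS /= addrC.
- have -> : Negz n - 1 = Negz n.+1 by rewrite !NegzE -opprD -PoszD addn1.
  have -> : Negz n - 2 = Negz n.+2 by rewrite !NegzE -opprD -PoszD addn2.
  rewrite /fibseq !iterS /=; set p := iter n _ _.
  by rewrite [RHS]addrC subrK.
Qed.

Definition gbinom (R : numFieldType) (x : R) (k : nat) : R :=
  (\prod_(i < k) (x - i%:R)) / k`!%:R.

Notation "F_[ j ]" := ((fib j)%:~R) (at level 0, j at level 200, format "F_[ j ]") : ring_scope.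
Notation "L_[ j ]" := ((lucas j)%:~R) (at level 0, j at level 200, format "L_[ j ]") : ring_scope.

(* Main.v *)
(* Write [a = L_s / 2] and [d = sqrt 5 * F_s / 2], so that
   [a + d] is the [s]-th power of the golden ratio.  Comparing coefficients of
   [z ^ N] in [(1 - a z)^(x+1) / (1 - (a + d) z)
   = (1 - a z)^x / (1 - d z / (1 - a z))] gives
   [sum_k (-1)^k C(x+1,k) a^k (a+d)^(N-k)
    = sum_k C(x-N+k,k) (-a)^k d^(N-k)].
   Multiplying by the [t]-th power of the golden ratio and separating rational
   and irrational parts yields the four identities, for [N = 2n] and
   [N = 2n-1].  As [R] need not contain [sqrt 5], multiplication by [d] is
   replaced by an operation on pairs of sequences whose square is
   multiplication by [c = d ^ 2]. *)
Require Import Defs.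
From mathcomp Require Import all_boot all_order all_algebra.
From mathcomp Require Import ring zify.
Set Implicit Arguments.
Unset Strict Implicit.
Unset Printing Implicit Defensive.
Import Order.TTheory GRing.Theory Num.Theory.
Local Open Scope ring_scope.

(** * Addition formulas for Fibonacci and Lucas numbers *)

Lemma fib_rec (j : int) : fib (j + 2) = fib (j + 1) + fib j.
Proof. by rewrite /fib fibseq_rec addrK -addrA. Qed.

Lemma lucas_rec (j : int) : lucas (j + 2) = lucas (j + 1) + lucas j.
Proof. by rewrite /lucas fibseq_rec addrK -addrA. Qed.

(** Two-step induction in both directions; downwards, the recurrence determines [f j] by cancelling
    [f (j + 1)] from [f (j + 2)]. *)
Lemma fib_like_eq (f g : int -> int) :
    (forall j, f (j + 2) = f (j + 1) + f j) ->
    (forall j, g (j + 2) = g (j + 1) + g j) ->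
  f 0 = g 0 -> f 1 = g 1 -> f =1 g.
Proof.
move=> fS gS fg0 fg1.
have pos (n : nat) : f n%:Z = g n%:Z /\ f (n%:Z + 1) = g (n%:Z + 1).
  elim: n => [|n [IH0 IH1]]; first by rewrite add0r.
  have -> : n.+1%:Z = n%:Z + 1 by lia.
  by split=> //; rewrite -addrA fS gS IH0 IH1.
have neg (n : nat) : f (- n%:Z) = g (- n%:Z) /\ f (- n%:Z + 1) = g (- n%:Z + 1).
  elim: n => [|n [IH0 IH1]]; first by rewrite oppr0 add0r.
  have e1 : - n.+1%:Z + 1 = - n%:Z by lia.
  have e2 : - n.+1%:Z + 2 = - n%:Z + 1 by lia.
  have := fS (- n.+1%:Z); have := gS (- n.+1%:Z).
  by rewrite e1 e2 -IH0 -IH1 => -> /addrI.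
by case=> n; [case: (pos n) | rewrite NegzE; case: (neg n.+1)].
Qed.

Lemma lucas_fib (v : int) : lucas v = 2 * fib (v + 1) - fib v.
Proof.
apply: (@fib_like_eq lucas (fun v => 2 * fib (v + 1) - fib v)) => // j.
- exact: lucas_rec.
- have -> : j + 2 + 1 = j + 1 + 2 by ring.
  by rewrite !fib_rec; ring.
Qed.

(** This is the irrational part of the product of the [u]-th and [v]-th powers of the golden ratio,
    each half of [lucas j + sqrt 5 * fib j]; the factor 2 keeps it in [int]. For fixed [v] both
    sides satisfy the recurrence in [u], so [u = 0] and [u = 1] suffice. [lucas_add] is the rational
    part. *)
Lemma fib_add (u v : int) :
  2 * fib (u + v) = fib u * lucas v + lucas u * fib v.
Proof.
apply: (@fib_like_eq (fun u => 2 * fib (u + v))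
  (fun u => fib u * lucas v + lucas u * fib v)) => [j|j||].
- have -> : j + 2 + v = j + v + 2 by ring.
  have -> : j + 1 + v = j + v + 1 by ring.
  by rewrite fib_rec mulrDr.
- by rewrite fib_rec lucas_rec; ring.
- by rewrite add0r mul0r add0r.
- rewrite (lucas_fib v) [1 + v]addrC (_ : fib 1 = 1) // (_ : lucas 1 = 1) //.
  by ring.
Qed.

Lemma lucas_add (u v : int) :
  2 * lucas (u + v) = lucas u * lucas v + 5 * fib u * fib v.
Proof.
apply: (@fib_like_eq (fun u => 2 * lucas (u + v))
  (fun u => lucas u * lucas v + 5 * fib u * fib v)) => [j|j||].
- have -> : j + 2 + v = j + v + 2 by ring.
  have -> : j + 1 + v = j + v + 1 by ring.
  by rewrite lucas_rec mulrDr.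
- by rewrite fib_rec lucas_rec; ring.
- by rewrite add0r mulr0 mul0r addr0.
- rewrite (_ : lucas 1 = 1) // (_ : fib 1 = 1) // !lucas_fib.
  have -> : 1 + v + 1 = v + 2 by ring.
  by rewrite [1 + v]addrC fib_rec; ring.
Qed.

(** * Splitting sums by the parity of the index *)

Lemma sum_parity_odd (V : nmodType) (n : nat) (f : nat -> V) :
  \sum_(0 <= k < (2 * n).+1) f k
  = \sum_(0 <= k < n.+1) f (2 * k)%N + \sum_(1 <= k < n.+1) f (2 * k - 1)%N.
Proof.
elim: n => [|n IH]; first by rewrite big_nat1 big_nat1 big_geq // addr0.
have -> : (2 * n.+1)%N = (2 * n).+2 by lia.
rewrite big_nat_recr //= big_nat_recr //= IH.
rewrite [in RHS]big_nat_recr //= [X in _ = _ + X]big_nat_recr //=.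
have -> : (2 * n.+1)%N = (2 * n).+2 by lia.
by rewrite subn1 /= -!addrA; congr (_ + _); rewrite addrA addrC.
Qed.

Lemma sum_parity_even (V : zmodType) (n : nat) (f : nat -> V) :
  \sum_(0 <= k < 2 * n) f k
  = \sum_(0 <= k < n) f (2 * k)%N + \sum_(1 <= k < n.+1) f (2 * k - 1)%N.
Proof.
have := sum_parity_odd n f.
rewrite big_nat_recr //= [\sum_(0 <= k < n.+1) _]big_nat_recr //=.
by rewrite addrAC => /addIr.
Qed.

(** * Generalized binomials and the coefficient identity *)

Lemma gbinom0 (R : numFieldType) (x : R) : gbinom x 0 = 1.
Proof. by rewrite /gbinom big_ord0 divr1. Qed.

Lemma gbinom_pascal (R : numFieldType) (x : R) (k : nat) :
  gbinom (x + 1) k.+1 = gbinom x k.+1 + gbinom x k.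
Proof.
(* Peeling the first factor [x + 1] on the left and the last factor [x - k] on the right leaves the
   same product of the [x - i] for [i < k]; then [x + 1 = (x - k) + (k + 1)]. *)
rewrite /gbinom big_ord_recl big_ord_recr /= factS natrM.
under eq_bigr => i _ do
  rewrite /= /bump /= natrD [1%:R + _]addrC opprD addrACA subrr addr0.
have k0 : k`!%:R != 0 :> R by rewrite pnatr_eq0 -lt0n fact_gt0.
have k1 : k%:R + 1 != 0 :> R by rewrite natr1 pnatr_eq0.
rewrite -natr1; field.
by rewrite k0 k1.
Qed.

(* [E j k] plays the role of [d ^ j * (a + d) ^ k]. *)
Lemma gbinom_sum (R : numFieldType) (a x : R) (N : nat) (E : nat -> nat -> R) :
    (forall j k, E j k.+1 = a * E j k + E j.+1 k) ->
  \sum_(0 <= k < N.+1) gbinom (x + 1) k * (- a) ^+ k * E 0%N (N - k)%N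
  = \sum_(0 <= k < N.+1)
      gbinom (x - N%:R + k%:R) k * (- a) ^+ k * E (N - k)%N 0%N.
Proof.
move=> ES; rewrite !big_mkord; elim: N E ES => [|N IH] E ES.
  by rewrite !big_ord1 !gbinom0.
rewrite big_ord_recr /= subnn.
(* Each [E 0 (N.+1 - k)] splits by [ES]. The induction hypothesis applies to [E] and also to the
   shifted family [fun j => E j.+1], which is why [E] is generalized. *)
under eq_bigr => k _ do
  rewrite subSn -1?ltnS // ES mulrDr [_ * (a * _)]mulrCA.
rewrite big_split /= -mulr_sumr IH // (IH (fun j => E j.+1)) // -addrA.
pose F k := gbinom (x - N%:R + k%:R) k * (- a) ^+ k * E (N.+1 - k)%N 0%N.
(* The isolated last term of the left-hand sum is exactly the term [k = N.+1] of [F], because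
   [x + 1 = x - N + (N + 1)]. *)
have -> : \sum_(k < N.+1) gbinom (x - N%:R + k%:R) k * (- a) ^+ k
      * E (N - k).+1 0%N + gbinom (x + 1) N.+1 * (- a) ^+ N.+1 * E 0%N 0%N
    = \sum_(k < N.+2) F k.
  rewrite [in RHS]big_ord_recr /= [F N.+1]/F subnn; congr (_ + _ * _ * _).
    by apply: eq_bigr => k _; rewrite /F subSn // -ltnS.
  by congr gbinom; rewrite -natr1; ring.
rewrite [\sum_(k < N.+2) F k]big_ord_recl [in RHS]big_ord_recl.
rewrite /F /= !gbinom0 addrCA; congr (_ + _).
rewrite mulr_sumr -big_split /=; apply: eq_bigr => k _.
(* Term [k] of the sum multiplied by [a] meets term [k.+1] of [F]: since
   [a * (- a) ^+ k = - (- a) ^+ k.+1], the coefficients subtract, and Pascal's rule evaluates the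
   difference. *)
have -> : gbinom (x - N.+1%:R + k.+1%:R) k.+1
    = gbinom (x - N%:R + k.+1%:R) k.+1 - gbinom (x - N%:R + k%:R) k.
  have -> : x - N%:R + k.+1%:R = x - N%:R + k%:R + 1.
    by rewrite -natr1 addrA.
  rewrite gbinom_pascal addrK; congr gbinom.
  by rewrite -!natr1; ring.
by rewrite subSS exprS; ring.
Qed.

(** * Separating even and odd powers of [d] *)

Section CoupledSequences.

(* [H] plays the role of [d * G], and [c] that of [d ^ 2]. *)
Variables (R : numFieldType) (a c x : R) (G H : nat -> R).
Hypothesis GS : forall k, G k.+1 = a * G k + H k.
Hypothesis HS : forall k, H k.+1 = a * H k + c * G k.

(** This models [d ^ j * G k]: pairs of factors [d] become [c], and a leftover [d] turns [G] into
    [H]. *)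
Let E j k := c ^+ j./2 * (if odd j then H k else G k).

Let ES j k : E j k.+1 = a * E j k + E j.+1 k.
Proof.
rewrite /E /= uphalf_half; case: (odd j) => /=; rewrite ?GS ?HS.
  by rewrite add1n exprS; ring.
by rewrite add0n; ring.
Qed.

(** In [gbinom_sum] with [N = 2 * n], the exponent [N - k] of [d] has the parity of [k]: even [k]
    contribute to [G 0], odd [k] to [H 0] with the sign of an odd power of [- a]. For
    [N = 2 * n - 1], in [coupled_sum_odd], [G] and [H] trade places. *)
Lemma coupled_sum_even (n : nat) :
  \sum_(0 <= k < (2 * n).+1) gbinom (x + 1) k * (- a) ^+ k * G (2 * n - k)%N
  = G 0%N * (\sum_(0 <= k < n.+1)
      gbinom (x - 2 * n%:R + 2 * k%:R) (2 * k) * (a ^+ (2 * k) * c ^+ (n - k)))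
  - H 0%N * (\sum_(1 <= k < n.+1)
      gbinom (x - 2 * n%:R + 2 * k%:R - 1) (2 * k - 1)
      * (a ^+ (2 * k - 1) * c ^+ (n - k))).
Proof.
have := gbinom_sum x (2 * n) ES.
under eq_bigr => k _ do rewrite [E _ _]mul1r.
move=> ->; rewrite sum_parity_odd !mulr_sumr -sumrN; congr (_ + _).
  apply: eq_big_nat => k /andP[_ kn].
  rewrite -mulnBr /E [(2 * (n - k))%N]mul2n doubleK odd_double.
  by rewrite exprM sqrrN -exprM !natrM; ring.
apply: eq_big_nat => k /andP[k0 kn].
have -> : (2 * n - (2 * k - 1) = (n - k).*2.+1)%N by lia.
rewrite /E /= odd_double uphalf_double /=.
have -> : (2 * k - 1 = (k.-1).*2.+1)%N by lia.
rewrite -mul2n !exprS !exprM sqrrN.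
have -> : x - (2 * n)%:R + (2 * k.-1).+1%:R = x - 2 * n%:R + 2 * k%:R - 1.
  by rewrite -[in RHS](prednK k0) -!natr1 !natrM; ring.
by ring.
Qed.

Lemma coupled_sum_odd (n : nat) :
  \sum_(0 <= k < 2 * n) gbinom (x + 1) k * (- a) ^+ k * G (2 * n - k - 1)%N
  = H 0%N * (\sum_(0 <= k < n)
      gbinom (x - 2 * n%:R + 2 * k%:R + 1) (2 * k)
      * (a ^+ (2 * k) * c ^+ (n - k - 1)))
  - G 0%N * (\sum_(1 <= k < n.+1)
      gbinom (x - 2 * n%:R + 2 * k%:R) (2 * k - 1)
      * (a ^+ (2 * k - 1) * c ^+ (n - k))).
Proof.
(* For [n = 0] the index [2 * n - 1] would be truncated, but all sums are empty. *)
have [->|n0] := posnP n; first by rewrite !big_geq // !mulr0 subrr.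
have N1 : ((2 * n).-1.+1 = 2 * n)%N by lia.
have NR : (2 * n).-1%:R = 2 * n%:R - 1 :> R.
  by rewrite -natrM -[in RHS]N1 -natr1 addrK.
have := gbinom_sum x (2 * n).-1 ES; rewrite N1.
under eq_bigr => k _ do rewrite [E _ _]mul1r.
under [in X in _ = X -> _]eq_bigr => k _ do rewrite NR.
under [in X in _ -> X = _]eq_bigr => k _ do rewrite subnAC subn1.
move=> ->; rewrite sum_parity_even !mulr_sumr -sumrN; congr (_ + _).
  apply: eq_big_nat => k /andP[_ kn].
  have -> : ((2 * n).-1 - 2 * k = (n - k - 1).*2.+1)%N by lia.
  rewrite /E /= odd_double uphalf_double /=.
  rewrite exprM sqrrN -exprM.
  have -> : x - (2 * n%:R - 1) + (2 * k)%:R = x - 2 * n%:R + 2 * k%:R + 1.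
    by rewrite natrM; ring.
  by ring.
apply: eq_big_nat => k /andP[k0 kn].
have -> : ((2 * n).-1 - (2 * k - 1) = (n - k).*2)%N by lia.
rewrite /E odd_double doubleK.
have -> : (2 * k - 1 = (k.-1).*2.+1)%N by lia.
rewrite -mul2n !exprS !exprM sqrrN.
have -> : x - (2 * n%:R - 1) + (2 * k.-1).+1%:R = x - 2 * n%:R + 2 * k%:R.
  by rewrite -[in RHS](prednK k0) -!natr1 !natrM; ring.
by ring.
Qed.

End CoupledSequences.

(** * Specializing [a] and [c], and absorbing the factor [(4 / 5) ^+ n] *)

Section ScaledSums.

Variables (R : numFieldType) (f l x : R) (G K : nat -> R).
(** The pairs (Lucas, 5 times Fibonacci) and (Fibonacci, Lucas) obey the same rules, so one
    computation serves both the [L] and the [F] identities. *)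
Hypothesis GS : forall k, G k.+1 = (l * G k + f * K k) / 2.
Hypothesis KS : forall k, K k.+1 = (l * K k + 5 * f * G k) / 2.

Let H k := f / 2 * K k.

Let GS' k : G k.+1 = l / 2 * G k + H k.
Proof. by rewrite GS /H; field. Qed.

Let HS k : H k.+1 = l / 2 * H k + 5 / 4 * f ^+ 2 * G k.
Proof. by rewrite /H KS; field. Qed.

(** Of the [n] factors [4 / 5], [k] turn each [(l / 2) ^+ 2] into [l ^+ 2 / 5], and the other
    [n - k] cancel the [5 / 4]. *)
Let even_monomial (n k : nat) : (k <= n)%N ->
  (4 / 5) ^+ n * ((l / 2) ^+ (2 * k) * (5 / 4 * f ^+ 2) ^+ (n - k))
  = f ^+ (2 * (n - k)) * l ^+ (2 * k) / 5 ^+ k.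
Proof.
move=> /subnKC {1}<-; rewrite exprD !exprM mulrACA -!exprMn.
have -> : 4 / 5 * (l / 2) ^+ 2 = l ^+ 2 / 5 by field.
have -> : 4 / 5 * (5 / 4 * f ^+ 2) = f ^+ 2 by field.
by rewrite exprMn exprVn mulrC mulrA.
Qed.

Let odd_monomial (n k : nat) : (0 < k <= n)%N ->
  (4 / 5) ^+ n * ((l / 2) ^+ (2 * k - 1) * (5 / 4 * f ^+ 2) ^+ (n - k))
  = 2 * (f ^+ (2 * (n - k)) * l ^+ (2 * k - 1) / 5 ^+ k).
Proof.
case: n k => [|n] [|k] // kn; have := @even_monomial n k kn => nk.
have -> : (2 * k.+1 - 1 = (2 * k).+1)%N by lia.
(* One [4 / 5] is paired with a single [l / 2], giving [2 * (l / 5)]; the rest is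
   [even_monomial]. *)
rewrite subSS [(4 / 5) ^+ _]exprS [(l / 2) ^+ _]exprS [l ^+ _]exprS.
rewrite -(mulrA (l / 2)) mulrACA nk exprS; field.
by rewrite expf_neq0 // pnatr_eq0.
Qed.

Let shifted_monomial (n k : nat) : (k < n)%N ->
  (4 / 5) ^+ n * ((l / 2) ^+ (2 * k) * (5 / 4 * f ^+ 2) ^+ (n - k - 1))
  = 4 / 5 * (f ^+ (2 * (n - k - 1)) * l ^+ (2 * k) / 5 ^+ k).
Proof.
case: n => // n nk; have -> : (n.+1 - k - 1 = n - k)%N by lia.
by rewrite exprS -mulrA even_monomial.
Qed.

Lemma scaled_sum_even (n : nat) :
  G 0%N * (\sum_(0 <= k < n.+1)
      gbinom (x - 2 * n%:R + 2 * k%:R) (2 * k)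
      * (f ^+ (2 * (n - k)) * l ^+ (2 * k) / 5 ^+ k))
  - K 0%N * (\sum_(1 <= k < n.+1)
      gbinom (x - 2 * n%:R + 2 * k%:R - 1) (2 * k - 1)
      * (f ^+ (2 * (n - k) + 1) * l ^+ (2 * k - 1) / 5 ^+ k))
  = (4 / 5) ^+ n * (\sum_(0 <= k < (2 * n).+1)
      (-1) ^+ k * gbinom (x + 1) k * (l ^+ k * G (2 * n - k)%N / 2 ^+ k)).
Proof.
transitivity ((4 / 5) ^+ n * (\sum_(0 <= k < (2 * n).+1)
    gbinom (x + 1) k * (- (l / 2)) ^+ k * G (2 * n - k)%N)); last first.
  congr (_ * _); apply: eq_bigr => k _.
  by rewrite (exprNn (l / 2)) exprMn exprVn; ring.
rewrite (coupled_sum_even _ GS' HS) mulrBr mulrCA [in RHS](mulrCA _ (H 0%N)).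
rewrite /H !mulr_sumr; congr (_ - _); apply: eq_big_nat => k /andP[k0 kn].
  by rewrite [(4 / 5) ^+ n * _]mulrCA even_monomial.
rewrite [(4 / 5) ^+ n * _]mulrCA odd_monomial ?k0 // addn1 exprS.
by field; rewrite expf_neq0 // pnatr_eq0.
Qed.

Lemma scaled_sum_odd (n : nat) :
  G 0%N * (\sum_(1 <= k < n.+1)
      gbinom (x - 2 * n%:R + 2 * k%:R) (2 * k - 1)
      * (f ^+ (2 * (n - k)) * l ^+ (2 * k - 1) / 5 ^+ k))
  - K 0%N * (\sum_(0 <= k < n)
      gbinom (x - 2 * n%:R + 2 * k%:R + 1) (2 * k)
      * (f ^+ (2 * (n - k) - 1) * l ^+ (2 * k) / 5 ^+ (k + 1)))
  = (4 / 5) ^+ n * (\sum_(0 <= k < 2 * n)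
      (-1) ^ (k%:Z - 1) * gbinom (x + 1) k
      * (l ^+ k * G (2 * n - k - 1)%N / 2 ^+ (k + 1))).
Proof.
(* The factor [- (1 / 2)] produces the sign [(-1) ^ (k - 1)] and the denominator [2 ^+ (k + 1)]; it
   also reverses the difference in [coupled_sum_odd]. *)
transitivity ((4 / 5) ^+ n * (- (1 / 2) * \sum_(0 <= k < 2 * n)
    gbinom (x + 1) k * (- (l / 2)) ^+ k * G (2 * n - k - 1)%N)); last first.
  congr (_ * _); rewrite mulr_sumr; apply: eq_bigr => k _.
  rewrite expfzDr ?oppr_eq0 ?oner_eq0 // -exprnP exprN1 invrN1.
  rewrite (exprNn (l / 2)) exprMn exprVn addn1 exprS; field.
  by rewrite expf_neq0 // pnatr_eq0.
rewrite (coupled_sum_odd _ GS' HS) mulNr -mulrN opprB mulrCA !mulrBr.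
rewrite !(mulrCA _ (G 0%N)) !(mulrCA _ (H 0%N)).
rewrite /H !mulr_sumr; congr (_ - _); apply: eq_big_nat => k /andP[k0 kn].
  rewrite [(4 / 5) ^+ n * _]mulrCA odd_monomial ?k0 //; field.
  by rewrite expf_neq0 // pnatr_eq0.
rewrite [(4 / 5) ^+ n * _]mulrCA shifted_monomial //.
have -> : (2 * (n - k) - 1 = (2 * (n - k - 1)).+1)%N by lia.
rewrite addn1 !exprS; field.
by rewrite expf_neq0 // pnatr_eq0.
Qed.

End ScaledSums.

(** * The four identities *)

Theorem theorem9 (R : numFieldType) (m n : nat) (s t : int) :
  [/\
    L_[t] * (\sum_(0 <= k < n.+1)
        gbinom (m%:R - 2 * n%:R + 2 * k%:R) (2 * k)
        * (F_[s] ^+ (2 * (n - k)) * L_[s] ^+ (2 * k) / 5 ^+ k))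
    - F_[t] * (\sum_(1 <= k < n.+1)
        gbinom (m%:R - 2 * n%:R + 2 * k%:R - 1) (2 * k - 1)
        * (F_[s] ^+ (2 * (n - k) + 1) * L_[s] ^+ (2 * k - 1) / 5 ^+ (k - 1)))
    = (4 / 5) ^+ n * (\sum_(0 <= k < (2 * n).+1)
        (-1) ^+ k * gbinom (m%:R + 1) k
        * (L_[s] ^+ k * L_[s * (2 * n%:Z - k%:Z) + t] / 2 ^+ k)) :> R,

    F_[t] * (\sum_(0 <= k < n.+1)
        gbinom (m%:R - 2 * n%:R + 2 * k%:R) (2 * k)
        * (F_[s] ^+ (2 * (n - k)) * L_[s] ^+ (2 * k) / 5 ^+ k))
    - L_[t] * (\sum_(1 <= k < n.+1)
        gbinom (m%:R - 2 * n%:R + 2 * k%:R - 1) (2 * k - 1)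
        * (F_[s] ^+ (2 * (n - k) + 1) * L_[s] ^+ (2 * k - 1) / 5 ^+ k))
    = (4 / 5) ^+ n * (\sum_(0 <= k < (2 * n).+1)
        (-1) ^+ k * gbinom (m%:R + 1) k
        * (L_[s] ^+ k * F_[s * (2 * n%:Z - k%:Z) + t] / 2 ^+ k)) :> R,

    L_[t] * (\sum_(1 <= k < n.+1)
        gbinom (m%:R - 2 * n%:R + 2 * k%:R) (2 * k - 1)
        * (F_[s] ^+ (2 * (n - k)) * L_[s] ^+ (2 * k - 1) / 5 ^+ k))
    - F_[t] * (\sum_(0 <= k < n)
        gbinom (m%:R - 2 * n%:R + 2 * k%:R + 1) (2 * k)
        * (F_[s] ^+ (2 * (n - k) - 1) * L_[s] ^+ (2 * k) / 5 ^+ k))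
    = (4 / 5) ^+ n * (\sum_(0 <= k < 2 * n)
        (-1) ^ (k%:Z - 1) * gbinom (m%:R + 1) k
        * (L_[s] ^+ k * L_[s * (2 * n%:Z - k%:Z - 1) + t] / 2 ^+ (k + 1))) :> R
  &
    F_[t] * (\sum_(1 <= k < n.+1)
        gbinom (m%:R - 2 * n%:R + 2 * k%:R) (2 * k - 1)
        * (F_[s] ^+ (2 * (n - k)) * L_[s] ^+ (2 * k - 1) / 5 ^+ k))
    - L_[t] * (\sum_(0 <= k < n)
        gbinom (m%:R - 2 * n%:R + 2 * k%:R + 1) (2 * k)
        * (F_[s] ^+ (2 * (n - k) - 1) * L_[s] ^+ (2 * k) / 5 ^+ (k + 1)))
    = (4 / 5) ^+ n * (\sum_(0 <= k < 2 * n)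
        (-1) ^ (k%:Z - 1) * gbinom (m%:R + 1) k
        * (L_[s] ^+ k * F_[s * (2 * n%:Z - k%:Z - 1) + t] / 2 ^+ (k + 1))) :> R
  ].
Proof.
pose Ls k : R := L_[s * k%:Z + t]; pose Fs k : R := F_[s * k%:Z + t].
have two0 : 2 != 0 :> R by rewrite pnatr_eq0.
have step (k : nat) : s * k.+1%:Z + t = s + (s * k%:Z + t) by ring.
have LS k : Ls k.+1 = (L_[s] * Ls k + F_[s] * (5 * Fs k)) / 2.
  apply: (canRL (mulfK two0)); rewrite mulrC /Ls /Fs step.
  have /(congr1 (intmul (1 : R))) := lucas_add s (s * k%:Z + t).
  by rewrite !rmorphD !rmorphM /= => ->; ring.
have FS k : Fs k.+1 = (L_[s] * Fs k + F_[s] * Ls k) / 2.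
  apply: (canRL (mulfK two0)); rewrite mulrC /Ls /Fs step.
  have /(congr1 (intmul (1 : R))) := fib_add s (s * k%:Z + t).
  by rewrite !rmorphD !rmorphM /= => ->; ring.
have LS5 k : Ls k.+1 = (L_[s] * Ls k + 5 * F_[s] * Fs k) / 2.
  by rewrite LS; ring.
have FS5 k : 5 * Fs k.+1 = (L_[s] * (5 * Fs k) + 5 * F_[s] * Ls k) / 2.
  by rewrite FS; ring.
have L0 : Ls 0%N = L_[t] by rewrite /Ls mulr0 add0r.
have F0 : Fs 0%N = F_[t] by rewrite /Fs mulr0 add0r.
have idx k : (k <= 2 * n)%N -> (2 * n - k)%N%:Z = 2 * n%:Z - k%:Z by lia.
have idx1 k : (k < 2 * n)%N -> (2 * n - k - 1)%N%:Z = 2 * n%:Z - k%:Z - 1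
  by lia.
have pow5 k : 5 ^+ k != 0 :> R by rewrite expf_neq0 // pnatr_eq0.
split.
- have := scaled_sum_even m%:R LS FS5 n; rewrite L0 F0 => e.
  etransitivity; last (etransitivity; first exact: e).
    (* Here [K 0] is [5 * F_[t]]; its 5 lowers the denominator from [5 ^+ k] to [5 ^+ (k - 1)],
       where [0 < k] matters. In the third identity it lowers [5 ^+ (k + 1)] to [5 ^+ k]. *)
    congr (_ - _); rewrite [5 * _]mulrC -mulrA mulr_sumr; congr (_ * _).
    apply: eq_big_nat => k /andP[k0 _].
    by rewrite -[in 5 ^+ k](subnK k0) [5 ^+ (_ + 1)]exprD expr1; field.
  by congr (_ * _); apply: eq_big_nat => k /andP[_ kn]; rewrite /Ls idx.
- have := scaled_sum_even m%:R FS LS5 n; rewrite L0 F0 => ->.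
  by congr (_ * _); apply: eq_big_nat => k /andP[_ kn]; rewrite /Fs idx.
- have := scaled_sum_odd m%:R LS FS5 n; rewrite L0 F0 => e.
  etransitivity; last (etransitivity; first exact: e).
    congr (_ - _); rewrite [5 * _]mulrC -mulrA mulr_sumr; congr (_ * _).
    apply: eq_bigr => k _.
    by rewrite addn1 [5 ^+ _.+1]exprS; field.
  by congr (_ * _); apply: eq_big_nat => k /andP[_ kn]; rewrite /Ls idx1.
- have := scaled_sum_odd m%:R FS LS5 n; rewrite L0 F0 => ->.
  by congr (_ * _); apply: eq_big_nat => k /andP[_ kn]; rewrite /Fs idx1.
Qed.
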